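(* (The Incremental Lemma) Let $(D,W)$ be an NMU default theory, $q$ a literal and $S$ a set of literals such that $W\cup S$ is consistent and $S$ does not influence $q$ in $(D,W)$. Then the following hold: (1) (Monotonicity of brave reasoning) if $q$ is in some extension of $(D,W)$, then $q$ is in some extension of $(D,W\cup S)$; (2) (Monotonicity of skeptical reasoning) if $q$ is in every extension of $(D,W)$, then $q$ is in every extension of $(D,W\cup S)$.
   Context: For a set of formulas $T$, $T^*$ is its logical closure; $\neg\neg a=a$ for a letter $a$; for a literal $\ell$, $letter(\ell)$ is its letter. A set of literals is inconsistent if it contains some literal together with its negation. A normal mixed unary (NMU) default theory is a pair $(D,W)$ with $W$ a finite set of propositional literals and $D$ a finite set of defaults $\frac{\alpha:\beta}{\beta}$, where $\beta$ is a single literal and the prerequisite $\alpha$ is empty or a single literal. A set $\mathcal E$ is an extension of $(D,W)$ if $\mathcal E=\bigcup_{i\ge0}E_i$, where $E_0=W$ and $E_{i+1}=E_i^*\cup\{\beta \mid \frac{\alpha:\beta}{\beta}\in D,\ \alpha\in E_i \text{ (or } \alpha \text{ empty)},\ \neg\beta\notin\mathcal E\}$. The atomic dependency graph of an NMU theory $\Delta=(D,W)$ is the directed graph whose vertices are the letters occurring in $\Delta$, with an edge $(x,y)$ whenever letters $x$ and $y$ occur respectively in the prerequisite and the consequent of some default in $D$. A set of literals $S$ influences a literal $l$ in $\Delta$ if for some $t\in S$ there is a (possibly zero-length) path from $letter(t)$ to $letter(l)$ in the atomic dependency graph of $\Delta$. *)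

(* Defs.v *)
From Stdlib Require Import Relation_Operators.
From mathcomp Require Import all_boot.
From mathcomp Require Import boolp classical_sets functions cardinality.

Set Implicit Arguments.
Unset Strict Implicit.
Unset Printing Implicit Defensive.

Local Open Scope classical_set_scope.

Inductive formula (A : Type) : Type :=
| FVar of A
| FFalse
| FNot of formula A
| FAnd of formula A & formula A
| FOr of formula A & formula A
| FImp of formula A & formula A.

Fixpoint eval (A : Type) (v : A -> bool) (f : formula A) : bool :=
  match f with
  | FVar x => v x
  | FFalse => false
  | FNot g => ~~ eval v g
  | FAnd g h => eval v g && eval v h
  | FOr g h => eval v g || eval v h
  | FImp g h => eval v g ==> eval v h
  end.

Definition models (A : Type) (v : A -> bool) (T : set (formula A)) : Prop :=
  forall g, T g -> eval v g.

Definition logical_closure (A : Type) (T : set (formula A)) :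
  set (formula A) := [set f | forall v, models v T -> eval v f].

Inductive literal (A : Type) : Type := Pos of A | Neg of A.

Definition letter (A : Type) (l : literal A) : A :=
  match l with Pos x => x | Neg x => x end.

Definition lneg (A : Type) (l : literal A) : literal A :=
  match l with Pos x => Neg x | Neg x => Pos x end.

Definition lit_formula (A : Type) (l : literal A) : formula A :=
  match l with Pos x => FVar x | Neg x => FNot (FVar x) end.

Definition inconsistent (A : Type) (S : set (literal A)) : Prop :=
  exists l, S l /\ S (lneg l).

(* The default prereq : conseq / conseq, where None is the empty
   prerequisite; the justification of a normal default is its consequent. *)
Record default (A : Type) : Type :=
  Default { prereq : option (literal A); conseq : literal A }.

Record theory (A : Type) : Type :=
  Theory { defaults : set (default A); facts : set (literal A) }.

Definition NMU (A : Type) (Delta : theory A) : Prop :=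
  finite_set (defaults Delta) /\ finite_set (facts Delta).

Definition prereq_in (A : Type) (d : default A) (T : set (formula A)) : Prop :=
  match prereq d with None => True | Some a => T (lit_formula a) end.

Fixpoint stage (A : Type) (Delta : theory A) (E : set (formula A)) (i : nat) :
  set (formula A) :=
  match i with
  | 0 => [set lit_formula l | l in facts Delta]
  | j.+1 => logical_closure (stage Delta E j) `|`
      [set lit_formula (conseq d) | d in
        [set d | [/\ defaults Delta d, prereq_in d (stage Delta E j)
                   & ~ E (lit_formula (lneg (conseq d)))]]]
  end.

Definition extension (A : Type) (Delta : theory A) (E : set (formula A)) :
  Prop := E = \bigcup_i stage Delta E i.

Definition vertex (A : Type) (Delta : theory A) (x : A) : Prop :=
  (exists l, facts Delta l /\ letter l = x) \/
  (exists d, defaults Delta d /\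
     (letter (conseq d) = x \/
      exists a, prereq d = Some a /\ letter a = x)).

Definition edge (A : Type) (Delta : theory A) (x y : A) : Prop :=
  exists d a, [/\ defaults Delta d, prereq d = Some a,
                  letter a = x & letter (conseq d) = y].

(* The endpoints are required to be vertices because a zero-length path
   exists only at a vertex of the graph. *)
Definition connected_to (A : Type) (Delta : theory A) (x y : A) : Prop :=
  [/\ vertex Delta x, vertex Delta y & clos_refl_trans A (edge Delta) x y].

Definition influences (A : Type) (Delta : theory A) (S : set (literal A))
  (l : literal A) : Prop :=
  exists t, S t /\ connected_to Delta (letter t) (letter l).

(* Main.v *)
Require Import Defs.
From Stdlib Require Import Relation_Operators Operators_Properties.
From mathcomp Require Import all_boot.
From mathcomp Require Import boolp classical_sets functions cardinality.

Local Open Scope classical_set_scope.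

(** A consistent set of literals entails no literal outside itself, so an
    extension is determined by its literals: they form a maximal consistent
    set that can be derived from the facts by defaults whose consequents it
    contains ([process]); normality makes every such set extend to a maximal
    one. Let [N] be the set of letters from which the letter of [q] can be
    reached. Literals over [N] are derived using literals over [N] only, and
    no letter of [S] is in [N]. Hence the [N]-part of an extension of one of
    the two theories is a process of the other, and extends to an extension
    of it. *)

(** For an empty prerequisite the second premise of [derivable_default] is vacuous, so one
    constructor serves both kinds of default. *)
Inductive derivable {A : Type} (W : set (literal A)) (U : set (default A)) :
  set (literal A) :=
| derivable_fact l of W l : derivable W U l
| derivable_default d of U d
    & (forall a, prereq d = Some a -> derivable W U a) :
    derivable W U (conseq d).

(** Justifications need no separate test: as [X] is consistent, a consequent in [X] has its negation
    outside [X]. *)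
Definition process {A : Type} (D : set (default A)) (W X : set (literal A)) :=
  [/\ W `<=` X, ~ inconsistent X
    & X `<=` derivable W [set d | D d /\ X (conseq d)]].

Definition literal_extension {A : Type} (D : set (default A))
    (W X : set (literal A)) :=
  process D W X /\
  forall d, D d -> (forall a, prereq d = Some a -> X a) ->
    ~ X (lneg (conseq d)) -> X (conseq d).

(** * Consistent sets of literals and classical entailment *)

Lemma lnegK {A : Type} : involutive (@lneg A).
Proof. by case. Qed.

Lemma letter_lneg {A : Type} (l : literal A) : letter (lneg l) = letter l.
Proof. by case: l. Qed.

Lemma derivable_mono {A : Type} (W : set (literal A)) (U V : set (default A)) :
  U `<=` V -> derivable W U `<=` derivable W V.
Proof.
move=> UV l; elim=> {l} [l Wl|d Ud _ IH]; first exact: derivable_fact.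
by apply: derivable_default IH; exact: UV.
Qed.

Lemma consistent_add {A : Type} (X : set (literal A)) (l : literal A) :
  ~ inconsistent X -> ~ X (lneg l) -> ~ inconsistent (X `|` [set l]).
Proof.
move=> consX nXl [m [[Xm|->] [Xm'|/= E]]].
- by apply: consX; exists m.
- by apply: nXl; rewrite -E lnegK.
- by [].
- by case: l E {nXl}.
Qed.

Lemma consistent_model {A : Type} (X : set (literal A)) :
  ~ inconsistent X -> exists v, forall l, X l -> eval v (lit_formula l).
Proof.
move=> consX; exists (fun x => `[< X (Pos x) >]) => -[x|x] Xl /=.
  exact/asboolP.
by apply/negP => /asboolP Xx; apply: consX; exists (Pos x).
Qed.

Lemma eval_lneg {A : Type} (v : A -> bool) (l : literal A) :
  eval v (lit_formula (lneg l)) = ~~ eval v (lit_formula l).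
Proof. by case: l => x //=; rewrite negbK. Qed.

(** If [l] is not in [X], adding [lneg l] keeps [X] consistent, and a model of the enlarged set
    refutes [l]. *)
Lemma closure_literal {A : Type} (X : set (literal A)) (l : literal A) :
  ~ inconsistent X ->
  logical_closure [set lit_formula m | m in X] (lit_formula l) <-> X l.
Proof.
move=> consX; split=> [Cl|Xl v]; last by apply; exists l.
apply: contrapT => nXl.
have [v vX] : exists v, forall m, (X `|` [set lneg l]) m ->
    eval v (lit_formula m).
  by apply/consistent_model/consistent_add; rewrite ?lnegK.
have /negP : ~~ eval v (lit_formula l) by rewrite -eval_lneg; apply: vX; right.
by apply; apply: Cl => _ [m Xm <-]; apply: vX; left.
Qed.

Lemma closure_mono {A : Type} (T U : set (formula A)) :
  T `<=` U -> logical_closure T `<=` logical_closure U.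
Proof. by move=> TU f Tf v vU; apply: Tf => g /TU /vU. Qed.

Lemma closure_incl {A : Type} (T : set (formula A)) :
  T `<=` logical_closure T.
Proof. by move=> f Tf v; exact. Qed.

Lemma closure_idem {A : Type} (T : set (formula A)) :
  logical_closure (logical_closure T) `<=` logical_closure T.
Proof. by move=> f Cf v vT; apply: Cf => g; exact. Qed.

(** * Maximal processes *)

(** By normality, firing an unblocked default adds only its own justification, which disturbs
    neither consistency nor earlier derivations; so a maximal process is closed. *)
Lemma process_extends {A : Type} (D : set (default A)) (W X : set (literal A)) :
  process D W X -> exists2 Y, X `<=` Y & literal_extension D W Y.
Proof.
move=> [WX consX groundX].
(* Zorn is applied to the sets [Z] added to [X], so that the empty chain is covered by [X]
   itself. *)
have [F PF totF|Z [[WY consY groundY] maxZ]] :=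
  @Zorn_bigcup (literal A) [set Z | process D W (X `|` Z)].
  split=> [l /WX|[l []]|l [Xl|[Z FZ Zl]]]; first by left.
  - move=> [Xl|[Z FZ Zl]] [Xl'|[Z' FZ' Zl']].
    + by apply: consX; exists l.
    + by have [_ + _] := PF _ FZ'; apply; exists l; split; [left|right].
    + by have [_ + _] := PF _ FZ; apply; exists l; split; [right|left].
    + have [ZZ'|Z'Z] := totF _ _ FZ FZ'.
        have [_ + _] := PF _ FZ'; apply; exists l.
        by split; right => //; exact: ZZ'.
      have [_ + _] := PF _ FZ; apply; exists l.
      by split; right => //; exact: Z'Z.
  - by apply: derivable_mono (groundX _ Xl) => d [Dd Xd]; split=> //; left.
  - have [_ _ /(_ l (or_intror Zl))] := PF _ FZ.
    apply: derivable_mono => d [Dd [Xd|Zd]]; split=> //; first by left.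
    by right; exists Z.
exists (X `|` Z); first by move=> l; left.
split=> // d Dd prd nYd; apply: contrapT => Yd.
apply: (maxZ (Z `|` [set conseq d])).
  split; first by move=> l; left.
  by move=> /(_ (conseq d)) H; apply: Yd; right; apply: H; right.
rewrite /= setUA; split=> [l /WY|| l [Yl|->]]; first by left.
- exact: consistent_add.
- by apply: derivable_mono (groundY _ Yl) => e [De Ye]; split=> //; left.
- apply: derivable_default; first by split=> //; right.
  move=> a /prd /groundY; apply: derivable_mono => e [De Ye].
  by split=> //; left.
Qed.

(** * Extensions and their literals *)

(** This trades the selection of defaults by consequent for the test on justifications used in
    [stage]. Consistency gives one inclusion, closedness the other. *)
Lemma literal_extensionE {A : Type} (D : set (default A))
    (W X : set (literal A)) :
  literal_extension D W X ->
  X = derivable W [set d | D d /\ ~ X (lneg (conseq d))].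
Proof.
move=> [[WX consX groundX] closedX]; apply/seteqP; split=> l.
  move=> /groundX; apply: derivable_mono => d [Dd Xd]; split=> // Xd'.
  by apply: consX; exists (conseq d).
elim=> {l} [l /WX //|d [Dd nXd] _ prd]; exact: closedX.
Qed.

(** Prerequisites are literals, and closing the consistent set [G] logically yields no new literal,
    hence enables no new default. *)
Lemma stage_sub_closure {A : Type} (D : set (default A)) (W : set (literal A))
    (E : set (formula A)) (G := derivable W
      [set d | D d /\ ~ E (lit_formula (lneg (conseq d)))]) (i : nat) :
  ~ inconsistent G ->
  stage (Theory D W) E i `<=` logical_closure [set lit_formula l | l in G].
Proof.
move=> consG; elim: i => [|i IH] f /=.
  move=> [l Wl <-]; apply: closure_incl; exists l => //.
  exact: derivable_fact.
move=> [|[d [Dd prd nEd] <-]]; first by move/(closure_mono _ _ IH)/closure_idem.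
apply: closure_incl; exists (conseq d) => //.
apply: derivable_default => // a da; move: prd; rewrite /prereq_in da => /IH.
by move/closure_literal; apply.
Qed.

Lemma stage_mono {A : Type} (Delta : theory A) (E : set (formula A)) (i j : nat) :
  (i <= j)%N -> stage Delta E i `<=` stage Delta E j.
Proof.
move=> /subnK <-; elim: (j - i)%N => // k IH f /IH Ef.
by left; exact: closure_incl.
Qed.

Lemma derivable_stage {A : Type} (D : set (default A)) (W : set (literal A))
    (E : set (formula A)) (l : literal A) :
  derivable W [set d | D d /\ ~ E (lit_formula (lneg (conseq d)))] l ->
  exists i, stage (Theory D W) E i (lit_formula l).
Proof.
elim=> {l} [l Wl|d [Dd nEd] _]; first by exists 0; exists l.
case da: (prereq d) => [a|] IH.
  have [i Ea] := IH a erefl; exists i.+1; right; exists d => //.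
  by split=> //; rewrite /prereq_in da.
by exists 1; right; exists d => //; split=> //; rewrite /prereq_in da.
Qed.

Lemma extension_literals {A : Type} (D : set (default A))
    (W : set (literal A)) (E : set (formula A)) :
  ~ inconsistent W -> extension (Theory D W) E ->
  literal_extension D W [set l | E (lit_formula l)].
Proof.
move=> consW extE.
pose G := derivable W [set d | D d /\ ~ E (lit_formula (lneg (conseq d)))].
have GE l : G l -> E (lit_formula l).
  by move=> /derivable_stage [i Ei]; rewrite extE; exists i.
have consG : ~ inconsistent G.
  (* A default concluding [l] is blocked once [lneg l] is in [E], so both members of a clash in [G]
     must be facts. *)
  have GW l : G l -> G (lneg l) -> W l.
    by move=> []// d [_ nEd] _ /GE.
  move=> [l [Gl Gl']]; apply: consW; exists l; split; first exact: GW.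
  by apply: GW; rewrite ?lnegK.
have EG l : E (lit_formula l) -> G l.
  rewrite {1}extE => -[i _ /(stage_sub_closure _ _ _ _ consG)].
  by move/closure_literal; apply.
split; first split.
- by move=> l Wl; apply: GE; exact: derivable_fact.
- by move=> [l [/EG Gl /EG Gl']]; apply: consG; exists l.
- move=> l /EG; rewrite /G; elim=> {l} [l Wl|d [Dd nEd] prd IH].
    exact: derivable_fact.
  by apply: derivable_default => //; split=> //; apply/GE/derivable_default.
- move=> d Dd prd nEd; apply/GE/derivable_default; first by split.
  by move=> a /prd /EG.
Qed.

(** This serves to find one stage containing all the consequents of a finite set of defaults. *)
Lemma finite_uniform_bound {T : Type} (F : set T) (P : T -> nat -> Prop) :
  finite_set F -> (forall x i j, (i <= j)%N -> P x i -> P x j) ->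
  (forall x, F x -> exists i, P x i) -> exists i, forall x, F x -> P x i.
Proof.
move=> finF monoP exP.
(* The alias [{classic T}] supplies the decidable equality needed for membership in a sequence. *)
have [s Fs] : exists s : seq {classic T}, F = [set` s] by exact/finite_seqP.
rewrite {F finF}Fs in exP *.
elim: s exP => [|x s IH] exP; first by exists 0.
have [i Pi] : exists i, forall y, y \in s -> P y i.
  by apply: IH => y ys; apply: exP; rewrite /= inE ys orbT.
have [j Pj] := exP x (mem_head x s).
exists (maxn i j) => y /=; rewrite inE => /orP[/eqP ->|ys].
  by apply: monoP Pj; exact: leq_maxr.
by apply: monoP (Pi y ys); exact: leq_maxl.
Qed.

Lemma closure_extension {A : Type} (D : set (default A))
    (W X : set (literal A)) :
  finite_set D -> literal_extension D W X ->
  extension (Theory D W) (logical_closure [set lit_formula l | l in X]).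
Proof.
move=> finD extX; set E := logical_closure _.
have [[_ consX groundX] _] := extX.
have EX l : E (lit_formula l) = X l by apply/propext/closure_literal.
(* The defaults not blocked by [E] generate exactly [X], so [stage_sub_closure] keeps every stage
   inside [E]. *)
have XE : derivable W [set d | D d /\ ~ E (lit_formula (lneg (conseq d)))] = X.
  rewrite [RHS](literal_extensionE _ _ _ extX); congr derivable.
  by apply/funext => d /=; rewrite EX.
rewrite /extension; apply/seteqP; split; last first.
  move=> f [i _]; have := stage_sub_closure D W E i; rewrite XE; exact.
have [i Xi] : exists i, forall d, D d ->
    X (conseq d) -> stage (Theory D W) E i (lit_formula (conseq d)).
  apply: (finite_uniform_bound _ (fun d i => X (conseq d) ->
    stage (Theory D W) E i (lit_formula (conseq d)))) => //.
    by move=> d i j ij Xi /Xi; exact: stage_mono.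
  move=> d Dd; have [|nXd] := pselect (X (conseq d)); last by exists 0.
  by rewrite -{1}XE => /derivable_stage [i Ei]; exists i.
(* The finitely many consequents in [X] all appear by stage [i], whence a
   single logical closure yields all of [E]. *)
move=> f Ef; exists i.+1 => //; left; apply: closure_mono Ef => _ [l Xl <-].
case: (groundX _ Xl) => [k Wk|d [Dd Xd] _]; last exact: Xi.
by apply: (stage_mono _ _ 0) => //; exists k.
Qed.

(** * Transfer between the two theories *)

(** Since [N] is closed under predecessors, a derivation of a literal over [N] never leaves [N],
    where the two sets of facts agree. *)
Lemma process_restrict {A : Type} (D : set (default A))
    (W W' X : set (literal A)) (N : set A) :
  (forall d a, D d -> prereq d = Some a -> N (letter (conseq d)) ->
     N (letter a)) ->
  ~ inconsistent W' ->
  (forall l, N (letter l) -> W l <-> W' l) ->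
  process D W X ->
  process D W' (W' `|` (X `&` [set l | N (letter l)])).
Proof.
move=> predN consW' WW' [WX consX groundX]; split.
- by move=> l; left.
- move=> [l [[W'l|[Xl /= Nl]] [W'l'|[Xl' /= Nl']]]].
  + by apply: consW'; exists l.
  (* In a mixed clash the fact from [W'] has its letter in [N], so it lies in [W] and both literals
     are in [X]. *)
  + rewrite letter_lneg in Nl'.
    by apply: consX; exists l; split=> //; apply/WX/WW'.
  + apply: consX; exists l; split=> //; apply/WX/WW' => //.
    by rewrite letter_lneg.
  + by apply: consX; exists l.
- move=> l [W'l|[/groundX]]; first exact: derivable_fact.
  elim=> {l} [l Wl Nl|d [Dd Xd] _ IH Nd].
    by apply: derivable_fact; apply/WW'.
  apply: derivable_default; first by split=> //; right.
  by move=> a da; apply: IH => //; exact: predN da Nd.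
Qed.

(** Influence requires the endpoints of a path to be vertices; this provides the endpoint
    [letter q]. *)
Lemma process_vertex {A : Type} (D : set (default A)) (W X : set (literal A))
    (l : literal A) :
  process D W X -> X l -> vertex (Theory D W) (letter l).
Proof.
move=> [_ _ groundX] /groundX [k Wk|d [Dd _] _]; first by left; exists k.
by right; exists d; split=> //; left.
Qed.

Section Ancestors.
Context {A : Type} (D : set (default A)) (W S : set (literal A)).
Variable q : literal A.

Let N : set A :=
  [set x | clos_refl_trans A (edge (Theory D W)) x (letter q)].

Lemma ancestors_closed (d : default A) (a : literal A) :
  D d -> prereq d = Some a -> N (letter (conseq d)) -> N (letter a).
Proof.
by move=> Dd da; apply: rt_trans; apply: rt_step; exists d, a.
Qed.

Lemma ancestor_vertex (x : A) :
  vertex (Theory D W) (letter q) -> N x -> vertex (Theory D W) x.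
Proof.
move=> + Nx; case: (clos_rt_rt1n _ _ _ _ Nx) => // y z [d [a [Dd da <- _]]] _ _.
by right; exists d; split=> //; right; exists a.
Qed.

Lemma uninfluenced_facts (l : literal A) :
  ~ influences (Theory D W) S q -> vertex (Theory D W) (letter q) ->
  N (letter l) -> W l <-> (W `|` S) l.
Proof.
move=> noinfl qV Nl; split=> [|[//|Sl]]; first by left.
by case: noinfl; exists l; split=> //; split=> //; exact: ancestor_vertex.
Qed.

Lemma literal_extension_brave (X : set (literal A)) :
  ~ inconsistent (W `|` S) -> ~ influences (Theory D W) S q ->
  literal_extension D W X -> X q ->
  exists2 Y, literal_extension D (W `|` S) Y & Y q.
Proof.
move=> consWS noinfl [procX _] Xq.
have qV := process_vertex _ _ _ _ procX Xq.
have WWS l : N (letter l) -> W l <-> (W `|` S) l := uninfluenced_facts l noinfl qV.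
have [Y XY extY] := process_extends _ _ _
  (process_restrict _ _ _ _ _ ancestors_closed consWS WWS procX).
by exists Y => //; apply: XY; right; split=> //; exact: rt_refl.
Qed.

(** The part of [Y] over [N] grows into an extension [X] of the smaller theory, which contains [q].
    It remains to see that [X] gains nothing over [N] beyond [Y]. *)
Lemma literal_extension_skeptical (Y : set (literal A)) :
  ~ inconsistent W -> ~ influences (Theory D W) S q ->
  (forall X, literal_extension D W X -> X q) ->
  literal_extension D (W `|` S) Y -> Y q.
Proof.
move=> consW noinfl allq [procY closedY].
(* Some extension must exist for [allq] to place [q] in a process; one is grown from the facts
   alone. *)
have [X0 _ extX0] : exists2 X, W `<=` X & literal_extension D W X.
  apply: process_extends; split=> // l; exact: derivable_fact.
have qV := process_vertex _ _ _ _ extX0.1 (allq _ extX0).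
have WSW l : N (letter l) -> (W `|` S) l <-> W l.
  by move=> Nl; apply: iff_sym; exact: uninfluenced_facts.
have [X YX extX] := process_extends _ _ _
  (process_restrict _ _ _ _ _ ancestors_closed consW WSW procY).
have [[_ consX groundX] _] := extX.
have [WSY _ _] := procY.
suff XY l : X l -> N (letter l) -> Y l.
  by apply: XY (rt_refl _ _ _); exact: allq.
move=> /groundX; elim=> {l} [l Wl _|d [Dd Xd] _ IH Nd].
  by apply: WSY; left.
(* Were the default blocked in [Y], the negated consequent, being over [N], would pass to [X] and
   clash with the consequent there. *)
apply: closedY => // [a da|Yd].
  by apply: IH => //; exact: ancestors_closed da Nd.
apply: consX; exists (conseq d); split=> //; apply: YX; right.
by split=> //=; rewrite letter_lneg.
Qed.

End Ancestors.

Theorem lemma3p10 (A : Type) (D : set (default A)) (W : set (literal A))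
    (q : literal A) (S : set (literal A))
    (nmu : NMU (Theory D W))
    (consWS : ~ inconsistent (W `|` S))
    (noinfl : ~ influences (Theory D W) S q) :
  ((exists E, extension (Theory D W) E /\ E (lit_formula q)) ->
   (exists E, extension (Theory D (W `|` S)) E /\ E (lit_formula q)))
  /\
  ((forall E, extension (Theory D W) E -> E (lit_formula q)) ->
   (forall E, extension (Theory D (W `|` S)) E -> E (lit_formula q))).
Proof.
have [finD _] := nmu.
have consW : ~ inconsistent W.
  by move=> [l [Wl Wl']]; apply: consWS; exists l; split; left.
split=> [[E [extE Eq]]|allq E extE].
  have [Y extY Yq] := literal_extension_brave _ _ _ _ _ consWS noinfl
    (extension_literals _ _ _ consW extE) Eq.
  exists (logical_closure [set lit_formula l | l in Y]).
  split; first exact: closure_extension.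
  by apply/closure_literal => //; case: extY => -[].
apply: (literal_extension_skeptical _ _ _ _ _ consW noinfl _
  (extension_literals _ _ _ consWS extE)) => X extX.
have consX : ~ inconsistent X by case: extX => -[].
by apply/(closure_literal _ _ consX); apply: (allq (logical_closure _));
  exact: closure_extension.
Qed.
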